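(* Let $(G,d)$ be a boundedly compact, $p$-uniformly convex metric space, let $f:G\to\mathbb{R}$ have local uniform Lipschitz gradient along geodesics with constant $L>0$ on the convex subset $U\subset G$, let $x\in\mathrm{gi}(U)$, and let $\rho>0$ be small enough that $\mathbb S^{G_x}_\rho\subset\mathrm{gi}(U)$ (i.e. the endpoints $\gamma(1)$ of all $\gamma\in\mathbb S^{G_x}_\rho$ lie in $\mathrm{gi}(U)$), where $\mathbb S^{G_x}_\rho:=\{\gamma\in G_x\mid d(\gamma(0),\gamma(1))=\rho\}$. Then the function $Df(x)[\,\cdot\,]$ defined on $G_x^\circ$ is continuous and bounded, and there exist $\gamma_{\max},\gamma_{\min}\in G_x^\circ$ and $y_{\max},y_{\min}\in\mathbb S_\rho(x):=\{z\in G\mid d(x,z)=\rho\}$ such that $$Df(x)[\gamma_{\max}]=Df(x)[\gamma_{[x,y_{\max}]}]=\max_{\gamma\in\mathbb S^{G_x}_\rho}Df(x)[\gamma],\qquad Df(x)[\gamma_{\min}]=Df(x)[\gamma_{[x,y_{\min}]}]=\min_{\gamma\in\mathbb S^{G_x}_\rho}Df(x)[\gamma].$$ Moreover, $$Df(x)[\gamma_{[x,y_{\max}]}]=|D|f(x)\qquad\text{and}\qquad Df(x)[\gamma_{[x,y_{\min}]}]=-|D|f(x).$$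
   Context: Spaces. A metric space $(G,d)$ is uniquely geodesic if for all $x_0,x_1\in G$ there is a unique path $\gamma=\gamma_{[x_0,x_1]}:[0,1]\to G$ with $\gamma(0)=x_0$, $\gamma(1)=x_1$ and $d(\gamma(t),\gamma(s))=|t-s|\,d(x_0,x_1)$ for all $s,t\in[0,1]$; write $x_t=(1-t)x_0\oplus t x_1:=\gamma(t)$. It is $p$-uniformly convex ($p>1$, constant $c>0$) if it is uniquely geodesic and for all $x_0,x_1,y\in G$, $t\in[0,1]$: $d(x_t,y)^p\leq(1-t)d(x_0,y)^p+t\,d(x_1,y)^p-\frac c2 t(1-t)d(x_0,x_1)^p$. Boundedly compact means closed bounded sets are compact. For $x\in G$, $G_x:=\{\gamma_{[x,y]}\mid y\in G\}$ with metric $d_x(\gamma_1,\gamma_2):=d(\gamma_1(1),\gamma_2(1))$, and $G_x^\circ:=G_x\setminus\{\gamma_{[x,x]}\}$. A set $U\subset G$ is convex if it contains $\gamma_{[x,y]}(t)$ for all $x,y\in U$, $t\in[0,1]$. The geodesic interior of $V\subset G$ is $\mathrm{gi}(V):=\{x\in V\mid \forall y\in V\setminus\{x\}\ \exists\eta\in G_y^\circ,\ t\in(0,1)\text{ with }x=\eta(t)\}$. Derivatives. For $\gamma\in G_x$: $S^-f(x)[\gamma]:=\liminf_{t\searrow0}\frac{f(\gamma(t))-f(x)}{t}$, $S^+f(x)[\gamma]:=\limsup_{t\searrow0}\frac{f(\gamma(t))-f(x)}{t}$, $d^-f(x)[\gamma]:=\liminf_{\eta\to\gamma}S^-f(x)[\eta]$,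 $d^+f(x)[\gamma]:=\limsup_{\eta\to\gamma}S^+f(x)[\eta]$, where $\eta\to\gamma$ in $(G_x,d_x)$ and $\eta=\gamma$ is allowed. For $\gamma\in G_x^\circ$, $D^\pm f(x)[\gamma]:=d^\pm f(x)[\gamma]/d(\gamma(0),\gamma(1))$. $f$ is directionally differentiable at $x$ in direction $\gamma$ if $d^+f(x)[\gamma]=d^-f(x)[\gamma]=df(x)[\gamma]:=\lim_{t\searrow0}\frac{f(\gamma(t))-f(x)}{t}\in\mathbb{R}$; then $Df(x)[\gamma]:=df(x)[\gamma]/d(\gamma(0),\gamma(1))$ for $\gamma\in G_x^\circ$. The steepness of $f$ at $x$ is $|D|f(x):=\sup_{\gamma\in G_x^\circ}|D^+f(x)[\gamma]|\in[0,+\infty]$. Lipschitz gradient. For convex $U$, $C^1(U)$ is the set of continuous $f$ on $U$ such that $t\mapsto f(\gamma_{[x,y]}(t))$ is $C^1$ on $[0,1]$ for all distinct $x,y\in U$. $f$ has local uniform Lipschitz gradient along geodesics with constant $L$ on $U$ if $f\in C^1(U)$ and for all (distinct) $x,y\in U$, all $t,s\in[0,1)$, with $x_t=\gamma_{[x,y]}(t)$, $x_s=\gamma_{[x,y]}(s)$: $|Df(x_t)[\gamma_{[x_t,y]}]-Df(x_s)[\gamma_{[x_s,y]}]|\le L\,d(x_t,x_s)$.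
   Formalization: The inclusion of the sphere of radius ρ in gi(U) is required for all radii 0 < r ≤ ρ, not only at ρ (false otherwise: G = U = [-1,5], f(z) = z, x = 0, ρ = 2), and G is assumed to have at least two points. *)

(* Defs.v *)
From HB Require Import structures.
From mathcomp Require Import all_boot all_order all_algebra.
From mathcomp Require Import all_classical all_reals all_analysis.

Set Implicit Arguments.
Unset Strict Implicit.
Unset Printing Implicit Defensive.
Import Order.TTheory GRing.Theory Num.Theory.
Import numFieldNormedType.Exports.
Local Open Scope classical_set_scope.
Local Open Scope ring_scope.

(* Paths [0, 1] -> G are represented by functions R -> G of which only the
   values on [0, 1] are meaningful. *)
Definition is_geodesic (R : realType) (G : metricType R) (x0 x1 : G)
    (g : R -> G) : Prop :=
  [/\ g 0 = x0, g 1 = x1 &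
      forall t s : R, 0 <= t <= 1 -> 0 <= s <= 1 ->
        mdist (g t) (g s) = `|t - s| * mdist x0 x1].

HB.mixin Record Metric_isUniquelyGeodesic (R : realType) (G : Type)
    & Metric R G := {
  geod : G -> G -> R -> G ;
  geodP : forall x0 x1 : G, is_geodesic x0 x1 (geod x0 x1) ;
  geod_unique : forall (x0 x1 : G) (g : R -> G), is_geodesic x0 x1 g ->
    forall t : R, 0 <= t <= 1 -> g t = geod x0 x1 t
}.

#[short(type="uniqGeodesicType")]
HB.structure Definition UniquelyGeodesic (R : realType) :=
  { G of Metric R G & Metric_isUniquelyGeodesic R G }.

Definition puniformly_convex (R : realType) (G : uniqGeodesicType R)
    (p c : R) : Prop :=
  [/\ 1 < p, 0 < c &
      forall (x0 x1 y : G) (t : R), 0 <= t <= 1 ->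
        mdist (geod x0 x1 t) y `^ p <=
          (1 - t) * mdist x0 y `^ p + t * mdist x1 y `^ p
          - c / 2 * t * (1 - t) * mdist x0 x1 `^ p].

Definition metric_bounded (R : realType) (G : metricType R) (A : set G) : Prop :=
  exists M : R, forall x y : G, A x -> A y -> mdist x y <= M.

Definition boundedly_compact (R : realType) (G : metricType R) : Prop :=
  forall A : set G, closed A -> metric_bounded A -> compact A.

Definition geodesically_convex (R : realType) (G : uniqGeodesicType R)
    (U : set G) : Prop :=
  forall x y : G, U x -> U y -> forall t : R, 0 <= t <= 1 -> U (geod x y t).

(* [geodesics_at x] is the space G_x of all geodesics issuing from x. *)
Record geodesics_at (R : realType) (G : uniqGeodesicType R) (x : G) :=
  GeodesicAt {
    gpath :> R -> G ;
    gpathP : exists y : G, gpath = geod x y }.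

HB.instance Definition _ (R : realType) (G : uniqGeodesicType R) (x : G) :=
  gen_eqMixin (geodesics_at x).
HB.instance Definition _ (R : realType) (G : uniqGeodesicType R) (x : G) :=
  gen_choiceMixin (geodesics_at x).

Definition gseg (R : realType) (G : uniqGeodesicType R) (x y : G) :
    geodesics_at x :=
  GeodesicAt (ex_intro (fun z => geod x y = geod x z) y erefl).

Section geodesics_at_metric.
Context {R : realType} {G : uniqGeodesicType R} (x : G).
Implicit Types g : geodesics_at x.

Definition dgeod g1 g2 : R := mdist (g1 1) (g2 1).

Lemma dgeodxx g : dgeod g g = 0.
Proof. exact: mdistxx. Qed.

Lemma dgeod_positivity g1 g2 : dgeod g1 g2 = 0 -> g1 = g2.
Proof.
rewrite /dgeod => /mdist_positivity.
have gend y : geod x y 1 = y by case: (geodP x y).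
case: g1 g2 => [h1 [y1 e1]] [h2 [y2 e2]] /=; subst h1 h2.
by rewrite !gend => ->.
Qed.

Lemma dgeod_sym g1 g2 : dgeod g1 g2 = dgeod g2 g1.
Proof. exact: metric_sym. Qed.

Lemma dgeod_triangle g2 g1 g3 : dgeod g1 g3 <= dgeod g1 g2 + dgeod g2 g3.
Proof. exact: metric_triangle. Qed.

HB.instance Definition _ := @isMetric.Build R (geodesics_at x)
  dgeod dgeodxx dgeod_positivity dgeod_sym dgeod_triangle.

End geodesics_at_metric.

Definition nontrivial_geodesics (R : realType) (G : uniqGeodesicType R)
    (x : G) : set (geodesics_at x) := [set g | g <> gseg x x].

Definition geodesic_interior (R : realType) (G : uniqGeodesicType R)
    (V : set G) : set G :=
  [set x | V x /\ forall y : G, V y -> y <> x ->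
     exists h : geodesics_at y, nontrivial_geodesics h /\
       exists t : R, 0 < t < 1 /\ x = h t].

Definition sphere (R : realType) (G : metricType R) (x : G) (r : R) : set G :=
  [set z | mdist x z = r].

Definition geodesic_sphere (R : realType) (G : uniqGeodesicType R) (x : G)
    (r : R) : set (geodesics_at x) := [set g | mdist (g 0) (g 1) = r].

Section directional_derivatives.
Context {R : realType} {G : uniqGeodesicType R}.
Variables (f : G -> R) (x : G).
Implicit Type g : geodesics_at x.

Definition diff_quotient g (t : R) : R := (f (g t) - f x) / t.

Definition lower_slope g : \bar R :=
  limf_einf (fun t : R => (diff_quotient g t)%:E) 0^'+.

Definition upper_slope g : \bar R :=
  limf_esup (fun t : R => (diff_quotient g t)%:E) 0^'+.

(* [nbhs g] is taken in the metric space [geodesics_at x] and contains g in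
   each of its members, so h = g is allowed in the limits h -> g. *)
Definition lower_dderiv g : \bar R := limf_einf lower_slope (nbhs g).

Definition upper_dderiv g : \bar R := limf_esup upper_slope (nbhs g).

Definition upper_nderiv g : \bar R :=
  (upper_dderiv g * ((mdist (g 0) (g 1))^-1)%:E)%E.

(* Meaningful only if the limit exists; [directionally_differentiable]
   includes its existence. *)
Definition dderiv g : R := lim (diff_quotient g t @[t --> 0^'+]).

Definition directionally_differentiable g : Prop :=
  [/\ cvg (diff_quotient g t @[t --> 0^'+]),
      upper_dderiv g = (dderiv g)%:E & lower_dderiv g = (dderiv g)%:E].

Definition nderiv g : R := dderiv g / mdist (g 0) (g 1).

(* The supremum is taken in [\bar R]; it is nonnegative as soon as G has a
   point other than x. *)
Definition steepness : \bar R :=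
  ereal_sup [set `|upper_nderiv g|%E | g in @nontrivial_geodesics R G x].

End directional_derivatives.

(* Differentiability at the endpoints 0 and 1 is one-sided. *)
Definition C1_01 (R : realType) (h : R -> R) : Prop :=
  exists h' : R -> R, {within `[0, 1], continuous h'} /\
    forall t : R, 0 <= t <= 1 ->
      (h s - h t) / (s - t) @[s --> within `[0, 1] t^'] --> h' t.

Definition C1_on (R : realType) (G : uniqGeodesicType R) (U : set G)
    (f : G -> R) : Prop :=
  {within U, continuous f} /\
  forall x y : G, U x -> U y -> x <> y -> C1_01 (fun t : R => f (geod x y t)).

Definition lipschitz_gradient (R : realType) (G : uniqGeodesicType R)
    (U : set G) (L : R) (f : G -> R) : Prop :=
  C1_on U f /\
  forall x y : G, U x -> U y -> x <> y ->
    forall t s : R, 0 <= t < 1 -> 0 <= s < 1 ->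
      `|nderiv f (gseg (geod x y t) y) - nderiv f (gseg (geod x y s) y)|
        <= L * mdist (geod x y t) (geod x y s).

Definition is_max (R : realType) (A : set R) (m : R) : Prop :=
  A m /\ ubound A m.

Definition is_min (R : realType) (A : set R) (m : R) : Prop :=
  A m /\ lbound A m.

(* Main.v *)
Require Import Defs.
From HB Require Import structures.
From mathcomp Require Import all_boot all_order all_algebra.
From mathcomp Require Import all_classical all_reals all_analysis.
From mathcomp Require Import ring lra.
Import Order.TTheory GRing.Theory Num.Theory.
Import numFieldNormedType.Exports.
Local Open Scope classical_set_scope.
Local Open Scope ring_scope.

(* Uniform convexity makes geodesics depend continuously on their endpoint. The
   Lipschitz gradient gives |f(y) - f(x) - df(x)[y]| <= L d(x,y)^2 on the ball of
   radius rho, so df(x) is, locally uniformly in y, a limit of the continuous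
   functions y |-> (f(gamma_[x,y](t)) - f(x)) / t, hence continuous, and
   d^+f = d^-f = df. Df(x) is constant along a geodesic issuing from x, and every
   such geodesic reaches the sphere of radius rho after truncation or extension,
   so by compactness Df(x) attains on the sphere its extrema over G_x^o. Since
   geodesics extend through x, the values of Df(x) come in opposite pairs, and so
   the maximum is |D|f(x) and the minimum its opposite. *)

(** * Elementary geometry of geodesics and their endpoints *)

Section geodesics.
Set Implicit Arguments.
Unset Strict Implicit.
Context {R : realType} {G : uniqGeodesicType R}.
Implicit Types (x y z m : G) (a b t s u : R).

Lemma geod0 x y : geod x y 0 = x.
Proof. by case: (geodP x y). Qed.

Lemma geod1 x y : geod x y 1 = y.
Proof. by case: (geodP x y). Qed.

Lemma mdist_geod x y t s : 0 <= t <= 1 -> 0 <= s <= 1 ->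
  mdist (geod x y t) (geod x y s) = `|t - s| * mdist x y.
Proof. by case: (geodP x y) => _ _; apply. Qed.

Lemma mdist_geodl x y t : 0 <= t <= 1 -> mdist x (geod x y t) = t * mdist x y.
Proof.
move=> t01; rewrite -{1}(geod0 x y) mdist_geod ?lexx ?ler01//.
by rewrite sub0r normrN ger0_norm//; case/andP: t01.
Qed.

Lemma mdist_geodr x y t : 0 <= t <= 1 ->
  mdist y (geod x y t) = (1 - t) * mdist x y.
Proof.
move=> t01; rewrite -{1}(geod1 x y) mdist_geod ?lexx ?ler01//.
by rewrite ger0_norm// subr_ge0; case/andP: t01.
Qed.

Lemma convex01 a b u : 0 <= a <= 1 -> 0 <= b <= 1 -> 0 <= u <= 1 ->
  0 <= a + u * (b - a) <= 1.
Proof. by move=> /andP[? ?] /andP[? ?] /andP[? ?]; apply/andP; split; nra. Qed.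

(** The affinely reparametrized subpath is itself a geodesic, so uniqueness applies. The case
    [b < a] is included and covers reversed geodesics. *)
Lemma geod_reparam y z a b u : 0 <= a <= 1 -> 0 <= b <= 1 -> 0 <= u <= 1 ->
  geod (geod y z a) (geod y z b) u = geod y z (a + u * (b - a)).
Proof.
move=> a01 b01 u01.
apply/esym; apply: (geod_unique _ _ (fun u => geod y z (a + u * (b - a)))) => //.
split=> [||t s t01 s01].
- by rewrite mul0r addr0.
- by rewrite mul1r subrKC.
- rewrite !mdist_geod//; try exact: convex01.
  rewrite (distrC a) mulrA -normrM; congr (`|_| * _); ring.
Qed.

Lemma geodxx x t : 0 <= t <= 1 -> geod x x t = x.
Proof.
move=> t01; apply/mdist_positivity; rewrite metric_sym.
by rewrite mdist_geodl// mdistxx mulr0.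
Qed.

Lemma gseg_inv x (g : geodesics_at x) : g = gseg x (g 1).
Proof.
by apply: dgeod_positivity; rewrite /dgeod /= geod1 mdistxx.
Qed.

Lemma geodesics_at0 x (g : geodesics_at x) : g 0 = x.
Proof. by rewrite (gseg_inv g) /= geod0. Qed.

Lemma nontrivial_gseg x y : nontrivial_geodesics (gseg x y) <-> y <> x.
Proof.
split=> [+ yx|+ e]; first by rewrite yx; apply.
by apply; have := congr1 (fun g : geodesics_at x => g 1) e; rewrite /= !geod1.
Qed.

Lemma mdist_gt0P x y : y <> x -> 0 < mdist x y.
Proof. by move=> yx; rewrite mdist_gt0; apply/eqP => /esym. Qed.

End geodesics.

(** * Consequences of uniform convexity for geodesics *)

Section uniform_convexity.
Set Implicit Arguments.
Unset Strict Implicit.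
Context {R : realType} {G : uniqGeodesicType R} (p c : R).
Hypothesis Gconvex : puniformly_convex G p c.
Implicit Types (x y z m w : G) (a b t s u e : R).

Let p_gt0 : 0 < p.
Proof. by case: Gconvex => p1 _ _; exact: lt_trans p1. Qed.

Let c_gt0 : 0 < c. Proof. by case: Gconvex. Qed.

Lemma ler_powp a b : 0 <= a -> a <= b -> a `^ p <= b `^ p.
Proof.
move=> a0 ab; apply: ge0_ler_powR => //; first exact: ltW.
by rewrite nnegrE (le_trans a0).
Qed.

Lemma ler_powp_inv a b : 0 <= a -> 0 <= b -> a `^ p <= b `^ p -> a <= b.
Proof.
move=> a0 b0 ab; rewrite leNgt; apply/negP => ba.
by move: ab; rewrite leNgt gt0_ltr_powR.
Qed.

(* Uniform convexity at the midpoint [w] of [m] and [m'] puts [w] closer to [x]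
   than [a] and within [b] of [z]; the triangle inequality does the rest. *)
Lemma midpoint_gap x z m m' a b : b <= mdist x z ->
  mdist x m <= a -> mdist x m' <= a -> mdist z m <= b -> mdist z m' <= b ->
  c / 8 * mdist m m' `^ p <= a `^ p - (mdist x z - b) `^ p.
Proof.
move=> bD xma xm'a zmb zm'b.
have h01 : 0 <= (2^-1 : R) <= 1 by apply/andP; split; lra.
pose w := geod m m' 2^-1.
have cvx q r : mdist q m <= r -> mdist q m' <= r ->
    mdist q w `^ p <= r `^ p - c / 8 * mdist m m' `^ p.
  move=> qm qm'; case: Gconvex => _ _ /(_ m m' q _ h01).
  rewrite metric_sym => /le_trans; apply.
  have h := ler_powp (mdist_ge0 _ _) qm.
  have h' := ler_powp (mdist_ge0 _ _) qm'.
  rewrite !(metric_sym q) in h h'.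
  rewrite (_ : c / 2 * 2^-1 * (1 - 2^-1) = c / 8); last by field.
  lra.
have b_ge0 : 0 <= b by apply: le_trans zmb; exact: mdist_ge0.
have zw : mdist z w <= b.
  apply: ler_powp_inv => //; first exact: mdist_ge0.
  apply: le_trans (cvx _ _ zmb zm'b) _.
  by rewrite gerBl mulr_ge0 ?powR_ge0// divr_ge0// ltW.
have xw : mdist x z - b <= mdist x w.
  have := metric_triangle x w z; rewrite (metric_sym w); lra.
have := ler_powp _ xw; rewrite subr_ge0 => /(_ bD) h1.
have := cvx _ _ xma xm'a; lra.
Qed.

(** Compare [y] with the point of the geodesic at the same distance from [x]: here the two radii in
    [midpoint_gap] add up to [mdist x z], so its right-hand side vanishes and the points
    coincide. *)
Lemma geod_of_triangle_eq x y z : x <> z ->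
  mdist x y + mdist y z = mdist x z ->
  y = geod x z (mdist x y / mdist x z).
Proof.
move=> /nesym xz e.
have D0 := mdist_gt0P xz.
have xy0 := mdist_ge0 x y; have yz0 := mdist_ge0 y z.
set D := mdist x z in e D0 *.
have t01 : 0 <= mdist x y / D <= 1.
  by rewrite divr_ge0 ?(ltW D0)//= ler_pdivrMr// mul1r -e lerDl.
apply: mdist_positivity; apply/eqP; rewrite eq_le mdist_ge0 andbT.
have := @midpoint_gap x z y (geod x z (mdist x y / D)) (mdist x y) (mdist y z).
rewrite mdist_geodl// mdist_geodr// -/D mulrBl divfK ?gt_eqF// mul1r.
rewrite (metric_sym z) (_ : D - mdist x y = mdist y z); last by lra.
rewrite (_ : D - mdist y z = mdist x y); last by lra.
rewrite subrr !lexx => /(_ ltac:(lra) isT isT isT isT) h.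
rewrite leNgt; apply/negP => d0.
move: h; rewrite leNgt mulr_gt0//; first by rewrite divr_gt0.
exact: powR_gt0.
Qed.

(** If [y'] is near [y], both points at parameter [t] are barely farther than [t * D] from [x] and
    [(1 - t) * D] from [y], where [D] is the distance from [x] to [y], and [midpoint_gap] forces
    them together. *)
Lemma geod_continuous x t : 0 <= t <= 1 ->
  continuous (fun y => geod x y t).
Proof.
move=> t01 y; apply/metricType_numDomainType.cvgrPdist_lt => e e0.
have [t0 t1] := andP t01.
suff [s s0 hs] : exists2 s, 0 < s & forall y', mdist y y' < s ->
    mdist (geod x y t) (geod x y' t) < e.
  apply/metricType_numDomainType.nbhs_mdistP; exists s => //.
set D := mdist x y; have D0 : 0 <= D := mdist_ge0 _ _.
(* When [t * D = 0] the point is [x] itself and the triangle inequality suffices; otherwise the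
   power function is continuous at [t * D > 0]. *)
have [tD0|tD0] := eqVneq (t * D) 0.
  exists e => // y' yy'.
  have /mdist_positivity <- : mdist x (geod x y t) = 0 by rewrite mdist_geodl.
  rewrite mdist_geodl//.
  have : t * mdist x y' <= t * (D + mdist y y').
    by rewrite ler_wpM2l// metric_triangle.
  rewrite mulrDr tD0 add0r => /le_lt_trans; apply.
  by apply: le_lt_trans yy'; rewrite ler_piMl// mdist_ge0.
have {}tD0 : 0 < t * D by rewrite lt_def tD0 mulr_ge0.
(* [phi s > 0] means that [midpoint_gap] with radii [t * D + s] and [(1 - t) * D + 2 * s] leaves a
   gap smaller than [e]. *)
pose phi s := (t * D - 2 * s) `^ p + c / 8 * e `^ p - (t * D + s) `^ p.
have phi0 : 0 < phi 0.
  rewrite /phi mulr0 subr0 addr0 addrAC subrr add0r.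
  by rewrite mulr_gt0 ?powR_gt0// divr_gt0.
have pcont q : 0 < q -> {for q, continuous (fun r => r `^ p)}.
  move=> q0; apply/differentiable_continuous/derivable1_diffP.
  by apply: derivable_powR; rewrite in_itv/= q0.
have phic : phi s @[s --> 0] --> phi 0.
  apply: cvgB; [apply: cvgD; last exact: cvg_cst|].
    apply: (@continuous_comp _ _ _ (fun s => t * D - 2 * s) (fun r => r `^ p)).
      apply: cvgB; first exact: cvg_cst.
      by apply: cvgM; [exact: cvg_cst|exact: cvg_id].
    by apply: pcont; rewrite mulr0 subr0.
  apply: (@continuous_comp _ _ _ (fun s => t * D + s) (fun r => r `^ p)).
    by apply: cvgD; [exact: cvg_cst|exact: cvg_id].
  by apply: pcont; rewrite addr0.
have /nbhs_ballP[r /= r0 hr] : \forall s \near 0, 0 < phi s.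
  by move/cvgr_gt : phic; apply.
(* The first bound keeps [phi s] positive; the second keeps the radius around [y] at most [D], as
   [midpoint_gap] requires. *)
pose s := Num.min (r / 2) (t * D / 2).
have s0 : 0 < s by rewrite lt_min !divr_gt0.
have phis : 0 < phi s.
  apply: hr; rewrite /ball/= sub0r normrN gtr0_norm//.
  by rewrite (@le_lt_trans _ _ (r / 2)) ?ge_min ?lexx//; lra.
have s2 : s <= t * D / 2 by rewrite ge_min lexx orbT.
exists s => // y' yy'.
have D'1 : mdist x y' <= D + s.
  by apply: le_trans (metric_triangle _ y _) _; rewrite lerD2l ltW.
have D'ge0 := mdist_ge0 x y'; have yy'0 := mdist_ge0 y y'.
have Hb : (1 - t) * D + 2 * s <= D by nra.
have := @midpoint_gap x y (geod x y t) (geod x y' t) (t * D + s)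
  ((1 - t) * D + 2 * s) Hb.
rewrite !mdist_geodl// mdist_geodr// -/D.
move=> /(_ ltac:(lra)); have xm' : t * mdist x y' <= t * D + s by nra.
move=> /(_ xm' ltac:(lra)).
have ym' : mdist y (geod x y' t) <= (1 - t) * D + 2 * s.
  apply: le_trans (metric_triangle _ y' _) _; rewrite mdist_geodr//; nra.
move=> /(_ ym').
rewrite (_ : D - _ = t * D - 2 * s); last by ring.
move=> h; rewrite ltNge; apply/negP => /(ler_powp (ltW e0)) h'.
have : c / 8 * e `^ p <= c / 8 * mdist (geod x y t) (geod x y' t) `^ p.
  by rewrite ler_wpM2l// divr_ge0// ltW.
move: phis; rewrite /phi; lra.
Qed.

End uniform_convexity.

(** * Upper and lower limits of convergent functions *)

Section limf_cvg.
Context {R : realType} {T : choiceType} {X : filteredType T}.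
Variables (F : set_system X) (FF : ProperFilter F).

(** The filter is arbitrary because two are needed: [0^'+] for the slopes and [nbhs g] for the
    limits over nearby geodesics. *)
Lemma cvg_limf_esup (u : X -> R) (l : R) : u @ F --> l ->
  limf_esup (fun t => (u t)%:E) F = l%:E.
Proof.
move=> ul; apply/eqP; rewrite eq_le; apply/andP; split.
  apply/lee_addgt0Pr => e e0.
  pose V := [set t | u t < l + e].
  have FV : F V by move/cvgr_lt : ul; apply; rewrite ltrDl.
  apply: (@le_trans _ _ (ereal_sup ((fun t => (u t)%:E) @` V))).
    by apply: ereal_inf_lbound; exists V.
  by apply/ereal_supP => _ [t Vt <-]; rewrite -EFinD lee_fin ltW.
apply/ereal_infP => _ [V FV <-]; apply/lee_subgt0Pr => e e0.
have FW : F [set t | l - e < u t] by move/cvgr_gt : ul; apply; rewrite gtrBl.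
have [t [Vt ut]] := filter_ex (filterI FV FW).
apply: (@le_trans _ _ (u t)%:E); first by rewrite -EFinB lee_fin ltW.
by apply: ereal_sup_ubound; exists t.
Qed.

Lemma cvg_limf_einf (u : X -> R) (l : R) : u @ F --> l ->
  limf_einf (fun t => (u t)%:E) F = l%:E.
Proof.
move=> /cvgN ul; rewrite /limf_einf -[l]opprK EFinN; congr (- _)%E.
exact: cvg_limf_esup ul.
Qed.

End limf_cvg.

(** * Derivatives on the unit interval and difference quotients along geodesics *)

Section slopes.
Set Implicit Arguments.
Unset Strict Implicit.
Context {R : realType}.

(* The differentiability clause of [C1_01]. *)
Definition deriv01 (h h' : R -> R) : Prop := forall t : R, 0 <= t <= 1 ->
  (h s - h t) / (s - t) @[s --> within `[0, 1] t^'] --> h' t.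

Lemma deriv01P (h h' : R -> R) : deriv01 h h' <->
  forall t e : R, 0 <= t <= 1 -> 0 < e ->
    exists2 d : R, 0 < d & forall s : R, 0 <= s <= 1 -> s != t ->
      `|t - s| < d -> `|h' t - (h s - h t) / (s - t)| < e.
Proof.
split=> [H t e t01 e0|H t t01].
  have /cvgrPdist_lt/(_ e e0) := H t t01.
  rewrite !near_withinE => /nbhs_ballP[d /= d0 hd].
  by exists d => // s s01 st ts; apply: hd => //=; rewrite in_itv.
apply/cvgrPdist_lt => e e0; have [d d0 hd] := H t e t01 e0.
rewrite !near_withinE; apply/nbhs_ballP; exists d => //= s ts st s01.
by apply: hd => //; move: s01; rewrite /= in_itv.
Qed.

Lemma deriv01_derive (h h' : R -> R) (t : R) : deriv01 h h' -> 0 < t < 1 ->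
  is_derive t 1 h (h' t).
Proof.
move=> /deriv01P H /andP[t0 t1].
have t01 : 0 <= t <= 1 by rewrite !ltW.
have C : (u^-1 *: (h (u *: 1 + t) - h t)) @[u --> 0^'] --> h' t.
  apply/cvgrPdist_lt => e e0; have [d d0 hd] := H t e t01 e0.
  rewrite near_withinE; apply/nbhs_ballP.
  (* Staying below [t] and [1 - t] keeps [u + t] in the unit interval. *)
  exists (Num.min d (Num.min t (1 - t))) => /=.
    by rewrite !lt_min d0 t0 subr_gt0.
  move=> u; rewrite /ball/= sub0r normrN !lt_min => /and3P[ud ut ut1] u0.
  rewrite /GRing.scale/= mulr1 mulrC.
  rewrite !ltr_norml in ut ut1; move: ut ut1 => /andP[? ?] /andP[? ?].
  have := hd (u + t); rewrite addrK; apply.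
  - by apply/andP; split; lra.
  - by rewrite -subr_eq0 addrK.
  - by rewrite opprD addrCA subrr addr0 normrN.
by apply: DeriveDef; [apply/cvg_ex; exists (h' t)|apply/cvg_lim].
Qed.

Lemma deriv01_continuous (h h' : R -> R) : deriv01 h h' ->
  {within `[0, 1], continuous h}.
Proof.
move=> /deriv01P H; apply/subspace_continuousP => t /=; rewrite in_itv/= => t01.
apply/cvgrPdist_lt => e e0; have [d d0 hd] := H t 1 t01 ltr01.
rewrite near_withinE; apply/nbhs_ballP.
(* With tolerance 1, the difference quotients near [t] are bounded by [K], so increments from [t]
   are at most [K] times the distance. *)
pose K := `|h' t| + 1.
have K0 : 0 < K by rewrite ltr_wpDl.
exists (Num.min d (e / K)); rewrite /= ?lt_min ?d0 ?divr_gt0// => s.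
rewrite /ball/= lt_min in_itv/= => /andP[tsd tse] s01.
have [->|st] := eqVneq s t; first by rewrite subrr normr0.
have := hd s s01 st tsd; set q := _ / _ => hq.
have qK : `|q| < K by have := ler_normB (h' t) (h' t - q);
  rewrite opprB addrCA subrr addr0 /K; lra.
have st0 : s - t != 0 by rewrite subr_eq0.
rewrite distrC (_ : h s - h t = q * (s - t)); last by rewrite /q divfK.
rewrite normrM (distrC s); have ts0 := normr_ge0 (t - s).
apply: (@le_lt_trans _ _ (K * `|t - s|)); first by rewrite ler_wpM2r// ltW.
by rewrite mulrC -ltr_pdivlMr.
Qed.

(** By the mean value theorem the increment is [h' s] for some interior [s]. *)
Lemma deriv01_increment (h h' : R -> R) (K : R) : deriv01 h h' ->
  (forall s, 0 <= s < 1 -> `|h' s - h' 0| <= K) -> `|h 1 - h 0 - h' 0| <= K.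
Proof.
move=> H hK.
have [s|s] := @MVT R h h' 0 1 ltr01 _ (deriv01_continuous H).
  by rewrite in_itv => /= s01; exact: deriv01_derive.
rewrite in_itv/= => /andP[s0 s1] ->; rewrite subr0 mulr1.
by apply: hK; rewrite ltW.
Qed.

Context {G : uniqGeodesicType R}.
Implicit Types (x y z : G) (f : G -> R).

Lemma cvg_dderiv f x (g : geodesics_at x) (l : R) :
  diff_quotient f g t @[t --> 0^'+] --> l -> dderiv f g = l.
Proof. by move=> /cvg_lim; apply. Qed.

Lemma cvg_diff_quotientP f x (g : geodesics_at x) (l : R) :
  diff_quotient f g t @[t --> 0^'+] --> l <->
  forall e : R, 0 < e -> exists2 d : R, 0 < d &
    forall t, 0 < t -> t < d -> `|l - diff_quotient f g t| < e.
Proof.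
split=> [/cvgrPdist_lt H e e0|H]; last apply/cvgrPdist_lt => e e0.
  have := H e e0; rewrite near_withinE => /nbhs_ballP[d /= d0 hd].
  by exists d => // t t0 td; apply: hd => //; rewrite /ball/= sub0r normrN gtr0_norm.
have [d d0 hd] := H e e0.
rewrite near_withinE; apply/nbhs_ballP; exists d => //= t.
by rewrite /ball/= sub0r normrN => td t0; apply: hd => //; rewrite gtr0_norm in td.
Qed.

Lemma cvg_diff_quotient_trivial f x :
  diff_quotient f (gseg x x) t @[t --> 0^'+] --> (0 : R).
Proof.
apply/cvg_diff_quotientP => e e0; exists 1 => // t t0 t1.
by rewrite /diff_quotient /= geodxx ?subrr ?mul0r ?subrr ?normr0// !ltW.
Qed.

(** Chain rule: the subsegment moves the parameter at speed [b - a]. Taking [b < a] gives the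
    derivative in the backward direction, with its sign reversed. *)
Lemma deriv01_diff_quotient f y z (h' : R -> R) (a b : R) :
  deriv01 (fun t => f (geod y z t)) h' -> 0 <= a <= 1 -> 0 <= b <= 1 -> a != b ->
  diff_quotient f (gseg (geod y z a) (geod y z b)) t @[t --> 0^'+] -->
    (b - a) * h' a.
Proof.
move=> /deriv01P H a01 b01 ab; apply/cvg_diff_quotientP => e e0.
have [d d0 hd] := H a e a01 e0.
exists (Num.min d 1); first by rewrite lt_min d0 ltr01.
move=> t t0; rewrite lt_min => /andP[td t1].
have t01 : 0 <= t <= 1 by rewrite !ltW.
have ba1 : `|b - a| <= 1.
  move: a01 b01 => /andP[? ?] /andP[? ?].
  by rewrite ler_norml; apply/andP; split; lra.
have ba0 : b - a != 0 by rewrite subr_eq0 eq_sym.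
have tn0 : t != 0 by rewrite gt_eqF.
rewrite /diff_quotient /= geod_reparam//.
have := hd (a + t * (b - a)) (convex01 a01 b01 t01).
have -> : a - (a + t * (b - a)) = - (t * (b - a)) by ring.
rewrite normrN normrM gtr0_norm// -subr_eq0 addrAC subrr add0r.
rewrite mulf_neq0// => /(_ isT).
have td' : t * `|b - a| < d by apply: le_lt_trans td; rewrite ler_piMr// ltW.
move=> /(_ td'); apply: le_lt_trans.
set Q := f _ - f _.
have -> : (b - a) * h' a - Q / t = (b - a) * (h' a - Q / (t * (b - a))).
  by field; rewrite tn0 ba0.
by rewrite normrM ler_piMl.
Qed.

(** The truncated geodesic follows the full one at speed [a], so time [t] on the full one is time
    [t / a] on the truncated one. Differentiability thus passes from a short initial piece to the
    whole geodesic. *)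
Lemma cvg_diff_quotient_scale f x y (a l : R) : 0 < a <= 1 ->
  diff_quotient f (gseg x (geod x y a)) t @[t --> 0^'+] --> l ->
  diff_quotient f (gseg x y) t @[t --> 0^'+] --> l / a.
Proof.
move=> /andP[a0 a1] /cvg_diff_quotientP H; apply/cvg_diff_quotientP => e e0.
have [d d0 hd] := H (e * a) (mulr_gt0 e0 a0).
exists (Num.min d 1 * a); first by rewrite mulr_gt0// lt_min d0 ltr01.
move=> t t0; rewrite -ltr_pdivrMr// lt_min => /andP[tad ta1].
have ta0 : 0 < t / a by rewrite divr_gt0.
have := hd (t / a) ta0 tad.
rewrite /diff_quotient /=.
have := @geod_reparam _ _ x y 0 a (t / a).
rewrite geod0 lexx ler01 a1 !ltW// => /(_ isT isT isT) ->.
rewrite add0r subr0 divfK ?gt_eqF// -ltr_pdivrMr// -[X in _ / X](gtr0_norm a0).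
rewrite -normfV -normrM.
by congr (`|_| < _); field; rewrite !gt_eqF.
Qed.

End slopes.

(** * Existence, homogeneity and continuity of the directional derivative *)

Section lipschitz_directional_derivative.
Set Implicit Arguments.
Unset Strict Implicit.
Context {R : realType} {G : uniqGeodesicType R} (p c : R).
Hypothesis Gconvex : puniformly_convex G p c.
Variables (f : G -> R) (U : set G) (L : R).
Hypotheses (L_gt0 : 0 < L) (fL : lipschitz_gradient U L f).
Variables (x : G) (rho : R).
Hypotheses (xU : geodesic_interior U x) (rho_gt0 : 0 < rho).
Hypothesis rho_small : forall r : R, 0 < r <= rho ->
  forall g : geodesics_at x, geodesic_sphere r g -> geodesic_interior U (g 1).
Implicit Types (y z : G) (a t : R).

(** [rho_small] covers every sphere of positive radius up to [rho], and [xU] covers the centre. *)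
Lemma ball_geodesic_interior y : mdist x y <= rho -> geodesic_interior U y.
Proof.
move=> xy; have [->//|/eqP yx] := eqVneq y x.
have := @rho_small (mdist x y) _ (gseg x y); rewrite /geodesic_sphere /= geod0 geod1.
by apply=> //; rewrite mdist_gt0P.
Qed.

Lemma ball_sub y : mdist x y <= rho -> U y.
Proof. by case/ball_geodesic_interior. Qed.

Lemma C1_on_deriv01 y z : U y -> U z -> y <> z ->
  exists h' : R -> R, deriv01 (fun t => f (geod y z t)) h'.
Proof.
move=> Uy Uz yz; case: fL => [[_ /(_ y z Uy Uz yz) [h' [_ H]]] _].
by exists h'.
Qed.

Let U_x : U x. Proof. by case: xU. Qed.

Let mem0 : 0 <= (0 : R) <= 1. Proof. by rewrite lexx ler01. Qed.
Let mem1 : 0 <= (1 : R) <= 1. Proof. by rewrite lexx ler01. Qed.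

Lemma cvg_diff_quotient_ball y : y <> x -> mdist x y <= rho ->
  cvg (diff_quotient f (gseg x y) t @[t --> 0^'+]).
Proof.
move=> yx xy; have [h' H] := C1_on_deriv01 U_x (ball_sub xy) (nesym yx).
apply/cvg_ex; exists ((1 - 0) * h' 0).
have := deriv01_diff_quotient H mem0 mem1; rewrite geod0 geod1; apply.
by rewrite eq_sym oner_neq0.
Qed.

(** Since [f] is controlled only on [U], an arbitrary geodesic is first cut down to the ball;
    homogeneity then carries conclusions back. *)
Lemma shrink_into_ball y : y <> x -> exists2 a, 0 < a <= 1 & a * mdist x y <= rho.
Proof.
move=> /mdist_gt0P d0; exists (Num.min 1 (rho / mdist x y)).
  by rewrite lt_min ltr01 divr_gt0//= ge_min lexx.
by rewrite -ler_pdivlMr// ge_min lexx orbT.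
Qed.

Lemma geod_neq y a : 0 < a <= 1 -> y <> x -> geod x y a <> x.
Proof.
move=> /andP[a0 a1] /mdist_gt0P d0 e.
have := @mdist_geodl _ _ x y a; rewrite e mdistxx ltW// => /(_ a1)/esym/eqP.
by rewrite mulf_eq0 !gt_eqF.
Qed.

Lemma cvg_diff_quotient y :
  diff_quotient f (gseg x y) t @[t --> 0^'+] --> dderiv f (gseg x y).
Proof.
(* [dderiv] is defined as the [lim], so only existence is at stake. *)
suff: cvg (diff_quotient f (gseg x y) t @[t --> 0^'+]) by [].
have [->|/eqP yx] := eqVneq y x.
  by apply/cvg_ex; exists 0; exact: cvg_diff_quotient_trivial.
have [a a01 ad] := shrink_into_ball yx.
have a01' : 0 <= a <= 1 by case/andP: a01 => /ltW -> ->.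
have /cvg_ex[l hl] : cvg (diff_quotient f (gseg x (geod x y a)) t @[t --> 0^'+]).
  by apply: cvg_diff_quotient_ball; [exact: geod_neq|rewrite mdist_geodl].
by apply/cvg_ex; exists (l / a); exact: cvg_diff_quotient_scale hl.
Qed.

Lemma dderiv_scale y a : 0 < a <= 1 ->
  dderiv f (gseg x (geod x y a)) = a * dderiv f (gseg x y).
Proof.
move=> a01; have /cvg_dderiv -> := cvg_diff_quotient_scale a01 
    (@cvg_diff_quotient (geod x y a)).
by rewrite mulrC divfK// gt_eqF//; case/andP: a01.
Qed.

Lemma nderiv_scale y a : 0 < a <= 1 ->
  nderiv f (gseg x (geod x y a)) = nderiv f (gseg x y).
Proof.
move=> a01; rewrite /nderiv dderiv_scale//= !geod0 !geod1.
have a0 : a != 0 by case/andP: a01 => /gt_eqF ->.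
rewrite mdist_geodl; last by case/andP: a01 => /ltW -> ->.
by rewrite invfM mulrACA divff// mul1r.
Qed.

(** The Lipschitz gradient bounds the oscillation of the derivative of [f] along the geodesic to
    [z], and [deriv01_increment] turns this into a bound on the increment. *)
Lemma dderiv_ball_approx z : z <> x -> mdist x z <= rho ->
  `|f z - f x - dderiv f (gseg x z)| <= L * mdist x z ^+ 2.
Proof.
move=> zx xz; have Uz := ball_sub xz; have d0 := mdist_gt0P zx.
set d := mdist x z in d0 *.
have [h' H] := C1_on_deriv01 U_x Uz (nesym zx).
have slope s : 0 <= s < 1 -> dderiv f (gseg (geod x z s) z) = (1 - s) * h' s.
  move=> /andP[s0 s1]; have s01 : 0 <= s <= 1 by rewrite s0 ltW.
  have := deriv01_diff_quotient H s01 mem1; rewrite geod1 lt_eqF//.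
  by move=> /(_ isT)/cvg_dderiv.
(* The remaining segment has length [(1 - s) * d], which cancels the speed factor [1 - s]. *)
have nslope s : 0 <= s < 1 -> nderiv f (gseg (geod x z s) z) = h' s / d.
  move=> s01; rewrite /nderiv slope//= geod0 geod1.
  have /andP[s0 s1] := s01.
  rewrite metric_sym mdist_geodr ?s0 ?ltW// -/d.
  by rewrite invfM mulrACA divff ?mul1r// subr_eq0 gt_eqF.
have := @deriv01_increment _ _ h' (L * d ^+ 2) H.
have h0 : dderiv f (gseg x z) = h' 0.
  by have := slope 0; rewrite geod0 subr0 mul1r; apply; rewrite lexx ltr01.
rewrite geod0 geod1 h0; apply=> s s01.
have z01 : 0 <= (0 : R) < 1 by rewrite lexx ltr01.
have /andP[s0 s1] := s01.
case: fL => _ /(_ x z U_x Uz (nesym zx) s 0 s01 z01).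
have s01' : 0 <= s <= 1 by rewrite s0 ltW.
rewrite !nslope// mdist_geod// -/d subr0 (ger0_norm s0).
rewrite -mulrBl normrM normfV (gtr0_norm d0) ler_pdivrMr// => /le_trans; apply.
by rewrite -!mulrA ler_pM2l// -expr2 ler_piMl ?sqr_ge0// ltW.
Qed.

(** Apply [dderiv_ball_approx] at [geod x y t] and divide by [t]: the error is quadratic, so a
    factor [t] survives. *)
Lemma dderiv_approx y t : y <> x -> 0 < t <= 1 -> t * mdist x y <= rho ->
  `|diff_quotient f (gseg x y) t - dderiv f (gseg x y)|
    <= L * t * mdist x y ^+ 2.
Proof.
move=> yx t01 txy; have /andP[t0 t1] := t01.
have t01' : 0 <= t <= 1 by rewrite ltW.
have := @dderiv_ball_approx (geod x y t) (geod_neq t01 yx).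
rewrite mdist_geodl// dderiv_scale// => /(_ txy) h.
rewrite -(ler_pM2l t0) -[X in X * `|_|](gtr0_norm t0) -normrM /diff_quotient /=.
rewrite mulrBr mulrCA divff ?gt_eqF// mulr1; apply: le_trans h _.
by rewrite le_eqVlt; apply/orP; left; apply/eqP; ring.
Qed.

(** Continuity of [f] holds only relative to [U]; the strict inequality keeps [geod x y t] in the
    ball, hence in [U], for all [y] near [y0]. *)
Lemma diff_quotient_continuous_at y0 t : 0 < t <= 1 -> t * mdist x y0 < rho ->
  {for y0, continuous (fun y => diff_quotient f (gseg x y) t)}.
Proof.
move=> /andP[t0 t1] txy0; have t01 : 0 <= t <= 1 by rewrite ltW.
apply: cvgM; last exact: cvg_cst.
apply: cvgB; last exact: cvg_cst.
apply/cvgrPdist_lt => e e0 /=.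
have U0 : U (geod x y0 t) by apply: ball_sub; rewrite mdist_geodl// ltW.
case: fL => [[/subspace_continuousP/(_ _ U0)/cvgrPdist_lt/(_ e e0) + _] _].
rewrite near_withinE => nf.
have /(_ _ nf) := @geod_continuous _ _ _ _ Gconvex x t t01 y0.
rewrite /nbhs /= => ng.
have near_r : \forall y \near y0, mdist y0 y < rho - t * mdist x y0.
  by apply/metricType_numDomainType.nbhs_mdistP;
    exists (rho - t * mdist x y0) => //=; rewrite subr_gt0.
near=> y.
have hy : mdist y0 y < rho - t * mdist x y0 by near: y.
suff Uy : U (geod x y t) by move: Uy; near: y.
apply: ball_sub; rewrite mdist_geodl//.
have yy0 := mdist_ge0 y0 y.
have := ler_wpM2l (ltW t0) (metric_triangle x y0 y).
have : t * mdist y0 y <= mdist y0 y by rewrite ler_piMl.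
rewrite mulrDr; lra.
Unshelve. all: by end_near. Qed.

(* Uniformly on bounded sets of endpoints, the difference quotients at a small
   fixed [t] approximate the derivative, and they are continuous in [y]. *)
Lemma dderiv_continuous : continuous (fun y => dderiv f (gseg x y)).
Proof.
move=> y0; apply/cvgrPdist_lt => e e0.
pose K := mdist x y0 + 1.
have K0 : 0 < K by rewrite ltr_wpDl// mdist_ge0.
(* [K] bounds the distance to [x] within 1 of [y0]; the second entry gives [t * K < rho], the third
   makes the error of [dderiv_approx] at most [e / 3]. *)
pose t := Num.min 1 (Num.min (rho / K / 2) (e / 3 / (L * K ^+ 2))).
have LK0 : 0 < L * K ^+ 2 by rewrite mulr_gt0// exprn_gt0.
have t0 : 0 < t by rewrite !lt_min ltr01 !divr_gt0.
have t1 : t <= 1 by rewrite ge_min lexx.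
have t01 : 0 < t <= 1 by rewrite t0.
have tr : t <= rho / K / 2 by rewrite !ge_min lexx orbT.
have te : t <= e / 3 / (L * K ^+ 2) by rewrite !ge_min lexx !orbT.
have tK : t * K < rho.
  apply: (@le_lt_trans _ _ (rho / K / 2 * K)); first by rewrite ler_pM2r.
  by rewrite mulrAC divfK ?gt_eqF// ltr_pdivrMr// ltr_pMr// ltr1n.
have appr y : mdist x y <= K ->
    `|diff_quotient f (gseg x y) t - dderiv f (gseg x y)| <= e / 3.
  move=> xyK; have [->|/eqP yx] := eqVneq y x.
    rewrite (cvg_dderiv (cvg_diff_quotient_trivial _ _)).
    rewrite /diff_quotient /= geodxx ?t1 ?(ltW t0)// subrr mul0r subrr normr0.
    by rewrite divr_ge0// ltW.
  have xy0 := mdist_ge0 x y.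
  apply: le_trans (dderiv_approx yx t01 _) _.
    by apply: le_trans (ltW tK); rewrite ler_pM2l.
  apply: (@le_trans _ _ (t * (L * K ^+ 2))); last by rewrite -ler_pdivlMr.
  rewrite [leRHS]mulrCA -mulrA !ler_pM2l//.
  by rewrite ler_sqr ?nnegrE// (ltW K0).
have y0K : mdist x y0 <= K by rewrite /K; lra.
have tK0 : t * mdist x y0 < rho by apply: le_lt_trans tK; rewrite ler_pM2l.
have /cvgrPdist_lt/(_ (e / 3)) := diff_quotient_continuous_at t01 tK0.
rewrite divr_gt0// => /(_ isT) near_dq.
have near_d : \forall y \near y0, mdist y0 y < 1.
  by apply/metricType_numDomainType.nbhs_mdistP; exists 1 => //=.
near=> y.
have yK : mdist x y <= K.
  apply: le_trans (metric_triangle _ y0 _) _; rewrite lerD2l ltW//.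
  by near: y.
have h : `|diff_quotient f (gseg x y0) t - diff_quotient f (gseg x y) t| < e / 3.
  by near: y.
have := appr _ y0K; have := appr _ yK; move: h.
rewrite !ltr_norml !ler_norml => /andP[? ?] /andP[? ?] /andP[? ?].
by apply/andP; split; lra.
Unshelve. all: by end_near. Qed.

End lipschitz_directional_derivative.

(** * Extrema on the sphere and the steepness *)

Section sphere_extrema.
Set Implicit Arguments.
Unset Strict Implicit.
Context {R : realType} {G : uniqGeodesicType R} (p c : R).
Hypotheses (Gcompact : boundedly_compact G) (Gconvex : puniformly_convex G p c).
Variables (f : G -> R) (U : set G) (L : R).
Hypotheses (L_gt0 : 0 < L) (fL : lipschitz_gradient U L f).
Variables (x : G) (rho : R).
Hypotheses (xU : geodesic_interior U x) (rho_gt0 : 0 < rho).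
Hypothesis rho_small : forall r : R, 0 < r <= rho ->
  forall g : geodesics_at x, geodesic_sphere r g -> geodesic_interior U (g 1).
Implicit Types (y z : G) (a t : R).

Lemma mdist_continuous y : continuous (mdist y : G -> R).
Proof.
move=> z; apply/cvgrPdist_lt => e e0.
apply/metricType_numDomainType.nbhs_mdistP; exists e => //= z' zz'.
have := metric_triangle y z z'; have := metric_triangle y z' z.
rewrite (metric_sym z') => ? ?.
by apply: le_lt_trans zz'; rewrite ler_norml; apply/andP; split; lra.
Qed.

(* By compactness some extension of the geodesic within the ball is longest;
   its endpoint is a geodesic interior point of [U], so it lies on the sphere. *)
Lemma extend_to_sphere y : y <> x -> mdist x y <= rho ->
  exists2 z, mdist x z = rho & exists2 a, 0 < a <= 1 & y = geod x z a.
Proof.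
move=> yx xy; have d0 := mdist_gt0P yx.
(* Equality in the triangle inequality encodes that [y] lies between [x] and [z], as a closed
   condition. *)
pose E := [set z | mdist x y + mdist y z - mdist x z = 0] `&`
          [set z | mdist x z <= rho].
have Ey : E y by split => //=; rewrite mdistxx addr0 subrr.
have Ecompact : compact E.
  apply: Gcompact; last first.
    exists (rho + rho) => u v [_ /= xu] [_ /= xv].
    by apply: le_trans (metric_triangle _ x _) _; rewrite (metric_sym u) lerD.
  apply: closedI.
    apply: (closed_comp (f := fun z => mdist x y + mdist y z - mdist x z)
      (D := [set 0])); last exact: closed_eq.
    move=> z _; apply: cvgB; last exact: mdist_continuous.
    by apply: cvgD; [exact: cvg_cst|exact: mdist_continuous].
  apply: (closed_comp (f := mdist x) (D := [set r | r <= rho])).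
    by move=> z _; exact: mdist_continuous.
  exact: closed_le.
have [|z /set_mem[/= zE zrho] zmax] := compact_EVT_max (ex_intro _ _ Ey) Ecompact
    (f := mdist x).
  by apply: continuous_subspaceT => z; exact: mdist_continuous.
have yz := mdist_ge0 y z.
have zx : z <> x.
  by move=> e; move: zE; rewrite e mdistxx; have := mdist_ge0 y x; lra.
have z0 := mdist_gt0P zx.
suff zr : mdist x z = rho.
  exists z => //; exists (mdist x y / mdist x z).
    by rewrite divr_gt0//= ler_pdivrMr// mul1r; lra.
  by apply: (geod_of_triangle_eq Gconvex); [exact/nesym|lra].
apply/eqP; rewrite eq_le zrho/= leNgt; apply/negP => zlt.
have [_ /(_ x xU.1 (nesym zx)) [h [_ [t [/andP[t0 t1] zt]]]]] :=
  ball_geodesic_interior xU rho_small zrho.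
rewrite (gseg_inv h) /= in zt; set w := h 1 in zt.
have t01 : 0 <= t <= 1 by rewrite !ltW.
have zw : mdist x z = t * mdist x w by rewrite zt mdist_geodl.
have w0 : 0 < mdist x w by move: z0; rewrite zw pmulr_rgt0.
(* If [z] is strictly inside the ball, its geodesic from [x] continues to [w]; cutting at [b > t]
   gives a point of [E] farther than [z]. *)
pose b := Num.min 1 (rho / mdist x w).
have b1 : b <= 1 by rewrite ge_min lexx.
have bw : b * mdist x w <= rho by rewrite -ler_pdivlMr// ge_min lexx orbT.
have tb : t < b by rewrite lt_min t1 ltr_pdivlMr// -zw.
have b01 : 0 <= b <= 1 by rewrite b1 (le_trans (ltW t0))// ltW.
have xz' : mdist x (geod x w b) = b * mdist x w by rewrite mdist_geodl.
have zz' : mdist z (geod x w b) = (b - t) * mdist x w.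
  by rewrite zt mdist_geod// distrC gtr0_norm// subr_gt0.
have := zmax (geod x w b); rewrite leNgt xz' zw ltr_pM2r// tb => H.
suff : false by []; apply: H; apply/mem_set; split; rewrite /= xz'//.
have := metric_triangle x y (geod x w b); have := metric_triangle y z (geod x w b).
rewrite xz' zz'; lra.
Qed.

(* The geodesic from [y] to [x] extends beyond [x] inside [U], and [f] has a
   two-sided derivative at [x] along the extension. *)
Lemma nderiv_opp y : y <> x ->
  exists2 z, z <> x & nderiv f (gseg x z) = - nderiv f (gseg x y).
Proof.
move=> yx; wlog xy : y yx / mdist x y <= rho.
  move=> W; have [a a01 ad] := shrink_into_ball rho_gt0 yx.
  have := W _ (geod_neq a01 yx); rewrite (nderiv_scale fL xU rho_gt0 rho_small)//.
  by rewrite mdist_geodl; [apply|case/andP: a01 => /ltW -> ->].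
have Uy := ball_sub xU rho_small xy.
have [_ /(_ y Uy yx) [h [hn [t [/andP[t0 t1] xt]]]]] := xU.
rewrite (gseg_inv h) in hn xt; set w := h 1 in hn xt.
have /mdist_gt0P w0 := (nontrivial_gseg y w).1 hn.
rewrite /= in xt.
have t01 : 0 <= t <= 1 by rewrite !ltW.
(* This cuts the extension so that [z] stays within [rho] of [x], hence in [U]. *)
pose b := Num.min 1 (t + rho / mdist y w).
have b1 : b <= 1 by rewrite ge_min lexx.
have bw : (b - t) * mdist y w <= rho.
  by rewrite -ler_pdivlMr// lerBlDl ge_min lexx orbT.
have tb : t < b by rewrite lt_min t1 ltrDl divr_gt0.
have b0 : 0 < b by apply: lt_trans tb.
have b01 : 0 <= b <= 1 by rewrite b1 ltW.
pose z := geod y w b.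
have xz : mdist x z = (b - t) * mdist y w.
  by rewrite xt mdist_geod// distrC gtr0_norm// subr_gt0.
have Uz : U z by apply: (ball_sub xU rho_small); rewrite xz.
have yz : mdist y z = b * mdist y w by rewrite mdist_geodl.
have yz0 : 0 < mdist y z by rewrite yz mulr_gt0.
have zx : z <> x.
  move=> e; move: xz; rewrite e mdistxx => /esym/eqP.
  by rewrite mulf_eq0 subr_eq0 !gt_eqF.
have zy : y <> z by move=> e; move: yz0; rewrite -e mdistxx ltxx.
pose a := t / b.
have a0 : 0 < a by rewrite divr_gt0.
have a1 : a < 1 by rewrite ltr_pdivrMr// mul1r.
have a01 : 0 <= a <= 1 by rewrite !ltW.
have xa : x = geod y z a.
  have := @geod_reparam _ _ y w 0 b a; rewrite geod0 lexx ler01 => ->//.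
  by rewrite add0r subr0 divfK ?gt_eqF.
have [h' H] := C1_on_deriv01 fL Uy Uz zy.
have mem0 : 0 <= (0 : R) <= 1 by rewrite lexx ler01.
have mem1 : 0 <= (1 : R) <= 1 by rewrite lexx ler01.
exists z => //.
(* From [x], at parameter [a], the slopes towards [z] and [y] are [(1 - a) * h' a] and [- a * h' a];
   dividing by the lengths leaves opposite values. *)
have := deriv01_diff_quotient H a01 mem1.
rewrite geod1 lt_eqF// => /(_ isT)/cvg_dderiv.
have := deriv01_diff_quotient H a01 mem0.
rewrite geod0 gt_eqF// => /(_ isT)/cvg_dderiv.
rewrite -xa /nderiv /= !geod0 !geod1 => -> ->.
have -> : mdist x z = (1 - a) * mdist y z by rewrite metric_sym {1}xa mdist_geodr.
have -> : mdist x y = a * mdist y z by rewrite metric_sym {1}xa mdist_geodl.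
by field; rewrite !gt_eqF// subr_gt0.
Qed.

Lemma nderiv_on_sphere y : y <> x ->
  exists2 z, mdist x z = rho & nderiv f (gseg x z) = nderiv f (gseg x y).
Proof.
move=> yx; have [a a01 ad] := shrink_into_ball rho_gt0 yx.
have a01' : 0 <= a <= 1 by case/andP: a01 => /ltW -> ->.
have [|z zr [b b01 e]] := @extend_to_sphere (geod x y a) (geod_neq a01 yx).
  by rewrite mdist_geodl.
exists z => //; rewrite -(nderiv_scale fL xU rho_gt0 rho_small z b01) -e.
exact: (nderiv_scale fL xU rho_gt0 rho_small _ a01).
Qed.

Lemma nderiv_continuous y : y <> x ->
  {for y, continuous (fun y => nderiv f (gseg x y))}.
Proof.
move=> yx; rewrite /nderiv; apply: cvgM.
  exact: (dderiv_continuous Gconvex L_gt0 fL xU rho_gt0 rho_small).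
rewrite /= geod0 geod1.
under eq_fun do rewrite /= geod0 geod1.
apply: cvgV; first by rewrite gt_eqF// mdist_gt0P.
exact: mdist_continuous.
Qed.

Lemma sphere_neq y : sphere x rho y -> y <> x.
Proof. by move=> /= xy e; move: rho_gt0; rewrite -xy e mdistxx ltxx. Qed.

(** A second point of [G] makes the sphere nonempty, by extension. The bound holds in absolute value
    because each direction has one with the opposite derivative. *)
Lemma nderiv_sphere_max : (exists a b : G, a <> b) ->
  exists2 ymax, sphere x rho ymax &
    forall y, y <> x -> `|nderiv f (gseg x y)| <= nderiv f (gseg x ymax).
Proof.
move=> [u [v uv]].
have [y0 y0x] : exists y, y <> x.
  by have [ux|/eqP] := eqVneq u x; [exists v; rewrite -ux => /esym|exists u].
have [z0 z0r _] := nderiv_on_sphere y0x.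
have Scompact : compact (sphere x rho).
  apply: Gcompact.
    apply: (closed_comp (f := mdist x) (D := [set rho])); last exact: closed_eq.
    by move=> z _; exact: mdist_continuous.
  exists (rho + rho) => y z /= xy xz.
  by apply: le_trans (metric_triangle _ x _) _; rewrite (metric_sym y) xy xz.
have [|y /set_mem yS ymax] := compact_EVT_max (ex_intro _ _ z0r) Scompact
    (f := fun y => nderiv f (gseg x y)).
  apply/subspace_continuousP => y yS; apply: cvg_within_filter.
  exact/nderiv_continuous/sphere_neq.
have le_max z : z <> x -> nderiv f (gseg x z) <= nderiv f (gseg x y).
  by move=> /nderiv_on_sphere[z' z'r <-]; apply: ymax; apply/mem_set.
exists y => // z zx; rewrite ler_norml le_max// andbT lerNl.
by have [z' z'x <-] := nderiv_opp zx; exact: le_max.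
Qed.

(** The endpoint map preserves distances; it carries continuity in the endpoint over to the space of
    geodesics. *)
Lemma geod_end_continuous : continuous (fun g : geodesics_at x => g 1).
Proof.
move=> g.
apply/(@metricType_numDomainType.cvgrPdist_lt _ G _ _ (nbhs_filter g)) => e e0.
by apply/metricType_numDomainType.nbhs_mdistP; exists e.
Qed.

Lemma upper_slopeE (g : geodesics_at x) : upper_slope f g = (dderiv f g)%:E.
Proof.
rewrite (gseg_inv g); apply: cvg_limf_esup.
exact: (cvg_diff_quotient fL xU rho_gt0 rho_small).
Qed.

Lemma lower_slopeE (g : geodesics_at x) : lower_slope f g = (dderiv f g)%:E.
Proof.
rewrite (gseg_inv g); apply: cvg_limf_einf.
exact: (cvg_diff_quotient fL xU rho_gt0 rho_small).
Qed.

Lemma dderiv_geod_continuous : continuous (@dderiv R G f x).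
Proof.
rewrite (_ : @dderiv R G f x = fun g => dderiv f (gseg x (g 1))); last first.
  by apply/funext => g; rewrite {1}(gseg_inv g).
move=> g; apply: (@continuous_comp _ _ _ (fun g : geodesics_at x => g 1)
  (fun y => dderiv f (gseg x y))); first exact: geod_end_continuous.
exact: (dderiv_continuous Gconvex L_gt0 fL xU rho_gt0 rho_small).
Qed.

Lemma upper_dderivE (g : geodesics_at x) : upper_dderiv f g = (dderiv f g)%:E.
Proof.
rewrite /upper_dderiv (funext upper_slopeE); apply: cvg_limf_esup.
exact: dderiv_geod_continuous.
Qed.

Lemma lower_dderivE (g : geodesics_at x) : lower_dderiv f g = (dderiv f g)%:E.
Proof.
rewrite /lower_dderiv (funext lower_slopeE); apply: cvg_limf_einf.
exact: dderiv_geod_continuous.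
Qed.

Lemma upper_nderivE (g : geodesics_at x) : upper_nderiv f g = (nderiv f g)%:E.
Proof. by rewrite /upper_nderiv upper_dderivE -EFinM. Qed.

Lemma directionally_differentiable_geodesics (g : geodesics_at x) :
  directionally_differentiable f g.
Proof.
split; [|exact: upper_dderivE|exact: lower_dderivE].
rewrite (gseg_inv g).
exact: (cvg_diff_quotient fL xU rho_gt0 rho_small).
Qed.

Lemma nontrivial_end (g : geodesics_at x) : nontrivial_geodesics g -> g 1 <> x.
Proof. by rewrite {1}(gseg_inv g) => /nontrivial_gseg. Qed.

Lemma nderiv_within_continuous :
  {within @nontrivial_geodesics R G x, continuous (@nderiv R G f x)}.
Proof.
apply/subspace_continuousP => g /nontrivial_end g1.
apply: cvg_within_filter.
rewrite (_ : @nderiv R G f x = fun g => nderiv f (gseg x (g 1))); last first.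
  by apply/funext => h; rewrite {1}(gseg_inv h).
apply: (@continuous_comp _ _ _ (fun g : geodesics_at x => g 1)
  (fun y => nderiv f (gseg x y))); first exact: geod_end_continuous.
exact: nderiv_continuous.
Qed.

(** Reverse the direction of [ymax] and bring its endpoint to the sphere. When [ymax] is the point
    of [nderiv_sphere_max], the absolute bound makes this value minimal. *)
Lemma nderiv_sphere_min ymax : sphere x rho ymax ->
  exists2 ymin, sphere x rho ymin &
    nderiv f (gseg x ymin) = - nderiv f (gseg x ymax).
Proof.
move=> /sphere_neq/nderiv_opp[z /nderiv_on_sphere[y yr yz] zE].
by exists y => //; rewrite yz.
Qed.

Lemma steepnessE ymax : sphere x rho ymax ->
  (forall y, y <> x -> `|nderiv f (gseg x y)| <= nderiv f (gseg x ymax)) ->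
  steepness f x = (nderiv f (gseg x ymax))%:E.
Proof.
move=> ymaxS le_max; have ymaxx := sphere_neq ymaxS.
apply/eqP; rewrite eq_le; apply/andP; split.
  apply/ereal_supP => _ [g /nontrivial_end g1 <-].
  by rewrite upper_nderivE abse_EFin lee_fin (gseg_inv g) le_max.
apply: ereal_sup_ubound; exists (gseg x ymax); first exact/nontrivial_gseg.
rewrite upper_nderivE abse_EFin ger0_norm//.
(* The value at [ymax] is nonnegative because it bounds an absolute value. *)
exact: le_trans (le_max _ ymaxx).
Qed.

End sphere_extrema.

Theorem proposition4p3 (R : realType) (G : uniqGeodesicType R)
    (Gnontrivial : exists a b : G, a <> b)
    (Gcompact : boundedly_compact G)
    (p c : R) (Gconvex : puniformly_convex G p c)
    (f : G -> R) (U : set G) (Uconvex : geodesically_convex U)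
    (L : R) (L_gt0 : 0 < L) (fL : lipschitz_gradient U L f)
    (x : G) (xU : geodesic_interior U x)
    (rho : R) (rho_gt0 : 0 < rho)
    (rho_small : forall r : R, 0 < r <= rho ->
       forall g : geodesics_at x, geodesic_sphere r g ->
         geodesic_interior U (g 1)) :
  (forall g : geodesics_at x, nontrivial_geodesics g ->
     directionally_differentiable f g) /\
  {within @nontrivial_geodesics R G x, continuous (@nderiv R G f x)} /\
  [bounded nderiv f g | g in @nontrivial_geodesics R G x] /\
  exists (gmax gmin : geodesics_at x) (ymax ymin : G),
    [/\ nontrivial_geodesics gmax, nontrivial_geodesics gmin,
        sphere x rho ymax & sphere x rho ymin] /\
    [/\ nderiv f gmax = nderiv f (gseg x ymax) &
        is_max [set nderiv f g | g in @geodesic_sphere R G x rho]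
               (nderiv f gmax)] /\
    [/\ nderiv f gmin = nderiv f (gseg x ymin) &
        is_min [set nderiv f g | g in @geodesic_sphere R G x rho]
               (nderiv f gmin)] /\
    (nderiv f (gseg x ymax))%:E = steepness f x /\
    (nderiv f (gseg x ymin))%:E = (- steepness f x)%E.
Proof.
have [ymax ymaxS le_max] := nderiv_sphere_max Gcompact Gconvex L_gt0 fL xU
  rho_gt0 rho_small Gnontrivial.
have [ymin yminS minE] := nderiv_sphere_min Gcompact Gconvex fL xU
  rho_gt0 rho_small ymaxS.
have steepE := steepnessE Gconvex L_gt0 fL xU rho_gt0 rho_small ymaxS le_max.
have bnd (g : geodesics_at x) : nontrivial_geodesics g ->
    `|nderiv f g| <= nderiv f (gseg x ymax).
  by move=> /nontrivial_end g1; rewrite (gseg_inv g); exact: le_max.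
have ymaxx := sphere_neq rho_gt0 ymaxS.
have yminx := sphere_neq rho_gt0 yminS.
have sphere_nontrivial (g : geodesics_at x) :
    geodesic_sphere rho g -> nontrivial_geodesics g.
  move=> gr; rewrite (gseg_inv g); apply/nontrivial_gseg => g1.
  by move: gr rho_gt0; rewrite /geodesic_sphere /= geodesics_at0 g1 mdistxx => <-;
    rewrite ltxx.
have sphere_gseg y : sphere x rho y -> geodesic_sphere rho (gseg x y).
  by rewrite /geodesic_sphere /= geod0 geod1.
split.
  move=> g _; exact: (directionally_differentiable_geodesics Gconvex L_gt0 fL
    xU rho_gt0 rho_small).
split; first exact: (nderiv_within_continuous Gconvex L_gt0 fL xU rho_gt0 rho_small).
split.
  exists (nderiv f (gseg x ymax)); split; first exact: num_real.
  by move=> M /ltW leM g /= /bnd /le_trans; apply.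
exists (gseg x ymax), (gseg x ymin), ymax, ymin.
split; first by split => //; apply/nontrivial_gseg.
split.
  split => //; split; first by exists (gseg x ymax) => //; exact: sphere_gseg.
  by move=> _ [g /sphere_nontrivial/bnd/ler_normlW ? <-].
split.
  split => //; split; first by exists (gseg x ymin) => //; exact: sphere_gseg.
  move=> _ [g /sphere_nontrivial/bnd + <-].
  by rewrite minE ler_norml => /andP[].
by rewrite steepE minE.
Qed.
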